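(* Let $A$ and $B$ be C$^*$-algebras and let $T:A\to B$ be a contractive completely orthogonality preserving bounded linear operator. Let $\Phi_T:C_0((0,1])\otimes A\to B$ be the TRO homomorphism induced by $T$, satisfying $\Phi_T(w\otimes a)=T(a)$ for all $a\in A$, where $w(z)=z$ on $(0,1]$. Then $$TRO(T(A))=\Phi_T\bigl(C_0((0,1])\otimes A\bigr).$$
   Context: Two elements $a,b$ of a C$^*$-algebra are orthogonal, written $a\perp b$, if $ab^*=b^*a=0$. A linear map $T:A\to B$ between C$^*$-algebras is completely orthogonality preserving if for every $n\in\mathbb{N}$ the amplification $T_n:M_n(A)\to M_n(B)$, $T_n((a_{i,j}))=(T(a_{i,j}))$, satisfies: $x\perp y$ implies $T_n(x)\perp T_n(y)$. A linear map $\Phi$ between C$^*$-algebras is a TRO homomorphism if $\Phi(xy^*z)=\Phi(x)\Phi(y)^*\Phi(z)$ for all $x,y,z$. $C_0((0,1])$ is the C$^*$-algebra of continuous complex-valued functions on $(0,1]$ vanishing at $0$, and $C_0((0,1])\otimes A$ is the C$^*$-algebra tensor product. For every contractive completely orthogonality preserving operator $T:A\to B$ there is a unique TRO homomorphism $\Phi_T:C_0((0,1])\otimes A\to B$ with $\Phi_T(w\otimes a)=T(a)$ for all $a\in A$. $TRO(T(A))$ denotes the subTRO of $B$ generated by $T(A)$, i.e. the smallest norm-closed linear subspace of $B$ that contains $T(A)$ and is closed under the ternary product $(x,y,z)\mapsto xy^*z$. *)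

(* Defs.v *)
From HB Require Import structures.
From mathcomp Require Import all_boot all_order all_algebra.
From mathcomp Require Import all_classical all_reals all_analysis.
From mathcomp Require Import complex lra.

Set Implicit Arguments.
Unset Strict Implicit.
Unset Printing Implicit Defensive.

Import Order.TTheory GRing.Theory Num.Theory.
Import numFieldNormedType.Exports.

Local Open Scope classical_set_scope.
Local Open Scope ring_scope.
Local Open Scope complex_scope.

Reserved Notation "x ** y" (at level 40, left associativity).

(* Involutive rings without unit: MathComp rings are unital, whereas
   C*-algebras such as C_0((0,1]) need not be. *)
HB.mixin Record isStarRng A & GRing.Zmodule A := {
  smul : A -> A -> A ;
  star : A -> A ;
  smulA : associative smul ;
  smulDl : left_distributive smul +%R ;
  smulDr : right_distributive smul +%R ;
  starK : involutive star ;
  starD : {morph star : x y / x + y} ;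
  starM : forall x y, star (smul x y) = smul (star y) (star x)
}.

#[short(type="starRngType")]
HB.structure Definition StarRng := {A of GRing.Zmodule A & isStarRng A}.

Notation "x ** y" := (smul x y) : ring_scope.

HB.mixin Record isCStarAlgebra (R : realType) A
    & CompleteNormedModule R[i] A & StarRng A := {
  scale_smulAl : forall (c : R[i]) (x y : A), c *: (x ** y) = (c *: x) ** y ;
  scale_smulAr : forall (c : R[i]) (x y : A), c *: (x ** y) = x ** (c *: y) ;
  starZ : forall (c : R[i]) (x : A), star (c *: x) = Num.conj c *: star x ;
  norm_smul_le : forall x y : A, `|x ** y| <= `|x| * `|y| ;
  cstar_identity : forall x : A, `|star x ** x| = `|x| ^+ 2
}.

#[short(type="cstarAlgType")]
HB.structure Definition CStarAlgebra (R : realType) :=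
  {A of CompleteNormedModule R[i] A & StarRng A & isCStarAlgebra R A}.

Section StarRngTheory.
Context (A : starRngType).
Implicit Types x y : A.

Lemma smul0r x : 0 ** x = 0.
Proof. by apply: (addrI (0 ** x)); rewrite -smulDl !addr0. Qed.

Lemma smulr0 x : x ** 0 = 0.
Proof. by apply: (addrI (x ** 0)); rewrite -smulDr !addr0. Qed.

Lemma star0 : star (0 : A) = 0.
Proof. by apply: (addrI (star 0)); rewrite -starD !addr0. Qed.

Lemma smul_suml (I : Type) (r : seq I) (F : I -> A) y :
  (\sum_(i <- r) F i) ** y = \sum_(i <- r) F i ** y.
Proof.
by elim: r => [|i r IH]; rewrite ?big_nil ?smul0r// !big_cons smulDl IH.
Qed.

Lemma smul_sumr (I : Type) (r : seq I) (F : I -> A) x :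
  x ** (\sum_(i <- r) F i) = \sum_(i <- r) x ** F i.
Proof.
by elim: r => [|i r IH]; rewrite ?big_nil ?smulr0// !big_cons smulDr IH.
Qed.

Lemma star_sum (I : Type) (r : seq I) (F : I -> A) :
  star (\sum_(i <- r) F i) = \sum_(i <- r) star (F i).
Proof.
by elim: r => [|i r IH]; rewrite ?big_nil ?star0// !big_cons starD IH.
Qed.

Definition orthogonal x y : Prop := x ** star y = 0 /\ star y ** x = 0.

Definition triple x y z : A := x ** star y ** z.

End StarRngTheory.

Section MatrixStarRng.
Context (A : starRngType) (n : nat).
Implicit Types x y z : 'M[A]_n.

Definition mx_smul x y : 'M[A]_n := \matrix_(i, j) \sum_k x i k ** y k j.

Definition mx_star x : 'M[A]_n := \matrix_(i, j) star (x j i).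

Let mx_smulA : associative mx_smul.
Proof.
move=> x y z; apply/matrixP => i j; rewrite !mxE.
under eq_bigr do rewrite mxE smul_sumr.
rewrite exchange_big /=; apply: eq_bigr => k _.
by rewrite mxE smul_suml; apply: eq_bigr => l _; rewrite smulA.
Qed.

Let mx_smulDl : left_distributive mx_smul +%R.
Proof.
move=> x y z; apply/matrixP => i j; rewrite !mxE -big_split /=.
by apply: eq_bigr => k _; rewrite mxE smulDl.
Qed.

Let mx_smulDr : right_distributive mx_smul +%R.
Proof.
move=> x y z; apply/matrixP => i j; rewrite !mxE -big_split /=.
by apply: eq_bigr => k _; rewrite mxE smulDr.
Qed.

Let mx_starK : involutive mx_star.
Proof. by move=> x; apply/matrixP => i j; rewrite !mxE starK. Qed.

Let mx_starD : {morph mx_star : x y / x + y}.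
Proof. by move=> x y; apply/matrixP => i j; rewrite !mxE starD. Qed.

Let mx_starM x y : mx_star (mx_smul x y) = mx_smul (mx_star y) (mx_star x).
Proof.
apply/matrixP => i j; rewrite !mxE star_sum.
by apply: eq_bigr => k _; rewrite !mxE starM.
Qed.

HB.instance Definition _ := isStarRng.Build 'M[A]_n
  mx_smulA mx_smulDl mx_smulDr mx_starK mx_starD mx_starM.

End MatrixStarRng.

(* Orthogonality in M_n(A) only involves the product and the involution of
   M_n(A), so its C*-norm is not needed. *)
Definition completely_orthogonality_preserving (A B : starRngType)
    (T : A -> B) : Prop :=
  forall (n : nat) (x y : 'M[A]_n),
    orthogonal x y -> orthogonal (map_mx T x) (map_mx T y).

Definition contractive (K : numDomainType) (A B : normedZmodType K)
    (T : A -> B) : Prop :=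
  forall a, `|T a| <= `|a|.

Definition TRO_hom (A B : starRngType) (f : A -> B) : Prop :=
  forall x y z, f (triple x y z) = triple (f x) (f y) (f z).

Section TRO.
Context (R : realType) (B : cstarAlgType R).

Definition subTRO (V : set B) : Prop :=
  [/\ closed V,
      V 0,
      forall (c : R[i]) x y, V x -> V y -> V (c *: x + y) &
      forall x y z, V x -> V y -> V z -> V (triple x y z)].

Definition TRO (S : set B) : set B := smallest subTRO S.

End TRO.

Definition bilinear_map (K : pzRingType) (U V W : lmodType K)
    (t : U -> V -> W) : Prop :=
  (forall v (c : K) u u', t (c *: u + u') v = c *: t u v + t u' v) /\
  (forall u (c : K) v v', t u (c *: v + v') = c *: t u v + t u v').

(* [D], together with [t : (a, b) |-> a (x) b], is a C*-completion of the
   algebraic tensor product of [A] and [B].  The third condition says that the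
   linear map from the algebraic tensor product to [D] given by [t] is
   injective: by the universal property, the element \sum_k a_k (x) b_k of the
   algebraic tensor product vanishes iff every bilinear map [s] sends it to 0.
   When [A] or [B] is nuclear (in particular commutative), there is exactly one
   such [D] up to isomorphism. *)
Definition cstar_tensor_product (R : realType) (A B D : cstarAlgType R)
    (t : A -> B -> D) : Prop :=
  [/\ bilinear_map t,
      forall a a' b b', t a b ** t a' b' = t (a ** a') (b ** b') /\
                        star (t a b) = t (star a) (star b),
      forall (n : nat) (a : 'I_n -> A) (b : 'I_n -> B),
        \sum_(k < n) t (a k) (b k) = 0 ->
        forall (W : lmodType R[i]) (s : A -> B -> W), bilinear_map s ->
          \sum_(k < n) s (a k) (b k) = 0 &
      dense [set d | exists (n : nat) (a : 'I_n -> A) (b : 'I_n -> B),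
                       d = \sum_(k < n) t (a k) (b k)]].

Section ComplexNorm.
Context (R : realType).
Implicit Types z : R[i].

Definition cnorm z : R := complex.Re `|z|.

Lemma cnormE z : `|z| = (cnorm z)%:C.
Proof. by rewrite /cnorm normc_def. Qed.

Lemma cnorm_ge0 z : 0 <= cnorm z.
Proof. by rewrite -lecR -cnormE normr_ge0. Qed.

Lemma cnormM z z' : cnorm (z * z') = cnorm z * cnorm z'.
Proof. by apply: complexI; rewrite -cnormE normrM !cnormE rmorphM. Qed.

Lemma cnormD z z' : cnorm (z + z') <= cnorm z + cnorm z'.
Proof. by rewrite -lecR rmorphD /= -!cnormE ler_normD. Qed.

Lemma cnormN z : cnorm (- z) = cnorm z.
Proof. by rewrite /cnorm normrN. Qed.

Lemma cnormJ z : cnorm (Num.conj z) = cnorm z.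
Proof. by rewrite /cnorm norm_conjC. Qed.

Lemma cnorm0 : cnorm 0 = 0.
Proof. by rewrite /cnorm normr0. Qed.

Lemma cnorm0_eq0 z : cnorm z = 0 -> z = 0.
Proof. by move=> z0; apply/normr0_eq0; rewrite cnormE z0. Qed.

Lemma cnorm_ge_Re z : `|complex.Re z| <= cnorm z.
Proof. by rewrite -lecR -cnormE normc_ge_Re. Qed.

Lemma cnorm_ge_Im z : `|complex.Im z| <= cnorm z.
Proof.
rewrite /cnorm normc_def /= -sqrtr_sqr ler_wsqrtr//.
by rewrite lerDr sqr_ge0.
Qed.

Lemma cnorm_le z : cnorm z <= `|complex.Re z| + `|complex.Im z|.
Proof.
rewrite /cnorm normc_def /=.
rewrite -(@ger0_norm _ (`|_| + `|_|)) ?addr_ge0// -sqrtr_sqr ler_wsqrtr//.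
rewrite sqrrD !real_normK ?num_real// addrAC lerDl.
by rewrite mulrn_wge0// mulr_ge0.
Qed.

Lemma cball (x y : R[i]^o) (e : R) :
  ball x e%:C y <-> cnorm (x - y) < e.
Proof. by rewrite -ball_normE /ball_ /= cnormE ltcR. Qed.

Lemma posc (e : R[i]) : 0 < e -> exists2 r : R, 0 < r & e = r%:C.
Proof.
move=> e0; exists (cnorm e); last by rewrite -cnormE gtr0_norm.
by rewrite -ltcR -cnormE normr_gt0 gt_eqF.
Qed.

Lemma cnbhs (T : topologicalType) (f : T -> R[i]^o) (x : T) :
  {for x, continuous f} <->
  forall e : R, 0 < e -> \forall y \near x, cnorm (f x - f y) < e.
Proof.
split.
  move=> /cvgrPdist_lt fx e e0; have /fx : 0 < e%:C by rewrite ltcR.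
  by apply: filterS => y; rewrite cnormE ltcR.
move=> h; apply/cvgrPdist_lt => _ /posc[e e0 ->].
by apply: filterS (h e e0) => y; rewrite cnormE ltcR.
Qed.

Lemma cnorm_continuous (T : topologicalType) (f : T -> R[i]^o) :
  continuous f -> continuous (fun x => cnorm (f x)).
Proof.
move=> cf x; apply/cvgrPdist_lt => e e0.
move/cnbhs : (cf x) => /(_ e e0); apply: filterS => y.
apply: le_lt_trans; rewrite ler_norml; apply/andP; split.
  rewrite lerNl opprB lerBlDr -(cnormN (f x - f y)) opprB.
  by rewrite (le_trans _ (cnormD _ _))// subrK.
by rewrite lerBlDr (le_trans _ (cnormD _ _))// subrK.
Qed.

End ComplexNorm.

Section C0.
Context (R : realType).

Definition Ioc01 : set R := `]0, 1].

Definition vanishing_at0 (f : Ioc01 -> R[i]) : Prop :=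
  forall e : R, 0 < e ->
  exists2 d : R, 0 < d & forall x : Ioc01, val x < d -> `|f x| < e%:C.

(* Continuity is with respect to the subspace topology that [set_type Ioc01]
   inherits from [R]; [R[i]^o] is [R[i]] with the topology of its norm. *)
Definition C0_pred : {pred Ioc01 -> R[i]^o} :=
  mem [set f : Ioc01 -> R[i]^o | continuous f /\ vanishing_at0 f].

Lemma C0_predP (f : Ioc01 -> R[i]^o) :
  reflect (continuous f /\ vanishing_at0 f) (f \in C0_pred).
Proof. by apply: (iffP idP) => [/set_mem|/mem_set]. Qed.

(* C_0((0,1]), with pointwise operations and the supremum norm. *)
Record C0 := MkC0 { C0_fun :> Ioc01 -> R[i]^o ; C0_funP : C0_fun \in C0_pred }.

HB.instance Definition _ := [isSub for C0_fun].
HB.instance Definition _ := [Choice of C0 by <:].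

Lemma C0_continuous (f : C0) : continuous f.
Proof. by case: (C0_predP _ (C0_funP f)). Qed.

Lemma C0_vanishing (f : C0) (e : R) : 0 < e ->
  exists2 d : R, 0 < d & forall x : Ioc01, val x < d -> cnorm (f x) < e.
Proof.
case: (C0_predP _ (C0_funP f)) => _ + e0 => /(_ e e0)[d d0 h].
by exists d => // x /h; rewrite cnormE ltcR.
Qed.

Lemma C0_predI (f : Ioc01 -> R[i]^o) :
  (forall (x : Ioc01) (e : R), 0 < e ->
     \forall y \near x, cnorm (f x - f y) < e) ->
  (forall e : R, 0 < e ->
     exists2 d : R, 0 < d & forall x : Ioc01, val x < d -> cnorm (f x) < e) ->
  f \in C0_pred.
Proof.
move=> cf vf; apply/C0_predP; split; first by move=> x; apply/cnbhs/cf.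
move=> e e0; have [d d0 h] := vf e e0.
by exists d => // x /h; rewrite cnormE ltcR.
Qed.

Lemma C0_near (f : C0) (x : Ioc01) (e : R) : 0 < e ->
  \forall y \near x, cnorm (f x - f y) < e.
Proof. by move: e; apply/cnbhs; exact: C0_continuous. Qed.

Let C0_submod : submod_closed C0_pred.
Proof.
split.
  apply: C0_predI => [x e e0|e e0].
    by apply: (@nearW _ (nbhs x)) => y; rewrite subrr cnorm0.
  by exists 1 => // x _; rewrite cnorm0.
move=> c f g f0 g0; apply: C0_predI => [x e e0|e e0].
  have K0 : 0 < cnorm c + 1 by rewrite ltr_wpDl ?cnorm_ge0.
  have e1 : 0 < e / 2 / (cnorm c + 1) by rewrite !divr_gt0.
  have e2 : 0 < e / 2 by rewrite divr_gt0.
  have := C0_near (MkC0 g0) x e2; have := C0_near (MkC0 f0) x e1.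
  apply: filterS2 => y /= hf hg.
  have -> : (c *: f + g) x - (c *: f + g) y
            = c * (f x - f y) + (g x - g y).
    by rewrite mulrBr opprD addrACA.
  rewrite (le_lt_trans (cnormD _ _))// [e]splitr ler_ltD// cnormM.
  rewrite (@le_trans _ _ ((cnorm c + 1) * cnorm (f x - f y)))//.
    by rewrite ler_wpM2r ?cnorm_ge0// lerDl.
  by rewrite mulrC -ler_pdivlMr// ltW.
have K0 : 0 < cnorm c + 1 by rewrite ltr_wpDl ?cnorm_ge0.
have e1 : 0 < e / 2 / (cnorm c + 1) by rewrite !divr_gt0.
have e2 : 0 < e / 2 by rewrite divr_gt0.
have [d1 d10 h1] := C0_vanishing (MkC0 f0) e1.
have [d2 d20 h2] := C0_vanishing (MkC0 g0) e2.
exists (Num.min d1 d2); first by rewrite lt_min d10.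
move=> x; rewrite lt_min => /andP[/h1 hf /h2 hg].
rewrite (le_lt_trans (cnormD _ _))// [e]splitr ler_ltD// cnormM.
rewrite (@le_trans _ _ ((cnorm c + 1) * cnorm (f x)))//.
  by rewrite ler_wpM2r ?cnorm_ge0// lerDl.
by rewrite mulrC -ler_pdivlMr// ltW.
Qed.

HB.instance Definition _ :=
  GRing.isSubmodClosed.Build R[i] (Ioc01 -> R[i]^o) C0_pred C0_submod.
HB.instance Definition _ := [SubChoice_isSubLmodule of C0 by <:].

Lemma C0_ext (f g : C0) : (forall x, f x = g x) -> f = g.
Proof. by move=> fg; apply/val_inj/funext. Qed.

Let one01 : Ioc01 1.
Proof. by rewrite /Ioc01 /= in_itv /= ltr01 lexx. Qed.

Let pt1 : Ioc01 := exist _ 1 (mem_set one01).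

Lemma C0_bounded (f : C0) : exists M : R, forall x, cnorm (f x) <= M.
Proof.
have [d d0 hd] := C0_vanishing f ltr01.
pose d' := Num.min d 1.
have d'0 : 0 < d' by rewrite lt_min d0 /=.
have d'1 : d' <= 1 by rewrite ge_min lexx orbT.
pose g : R -> R := valL_ (0 : R) (fun x : Ioc01 => cnorm (f x)).
have gE (x : Ioc01) : g (val x) = cnorm (f x).
  by have /(congr1 (fun h => h x)) :=
    (@valLK _ _ (0 : R) Ioc01 (fun x : Ioc01 => cnorm (f x))).
have cg : {within `[d', 1], continuous g}.
  apply: (@continuous_subspaceW _ _ _ Ioc01).
    move=> x /=; rewrite /Ioc01 /= !in_itv /= => /andP[dx ->].
    by rewrite (lt_le_trans d'0 dx).
  apply/(@subspace_valL_continuousP' _ Ioc01 R 0).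
  exact: cnorm_continuous (@C0_continuous f).
have [c _ hc] := EVT_max d'1 cg.
exists (Num.max 1 (g c)) => x; rewrite le_max.
have [xd|xd] := ltP (val x) d'.
  rewrite ltW ?hd//; by rewrite (lt_le_trans xd)// ge_min lexx.
rewrite -gE hc ?orbT// in_itv /= xd.
by have := set_mem (valP x); rewrite /Ioc01 /= in_itv /= => /andP[].
Qed.

Definition C0_sup (f : C0) : R := sup (range (fun x => cnorm (f x))).

Lemma C0_sup_has (f : C0) : has_sup (range (fun x => cnorm (f x))).
Proof.
split; first by exists (cnorm (f pt1)); exists pt1.
by have [M h] := C0_bounded f; exists M => _ [x _ <-].
Qed.

Lemma C0_sup_ge (f : C0) x : cnorm (f x) <= C0_sup f.
Proof. by apply: (sup_upper_bound (C0_sup_has f)); exists x. Qed.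

Lemma C0_sup_le (f : C0) M : (forall x, cnorm (f x) <= M) -> C0_sup f <= M.
Proof.
move=> h; apply: ge_sup; first by case: (C0_sup_has f).
by move=> _ [x _ <-].
Qed.

Lemma C0_sup_ge0 (f : C0) : 0 <= C0_sup f.
Proof. exact: le_trans (cnorm_ge0 _) (C0_sup_ge f pt1). Qed.

(* The supremum norm; as required by [normedModType R[i]] it takes values in
   [R[i]]. *)
Definition C0_norm (f : C0) : R[i] := (C0_sup f)%:C.

Let C0_normD f g : C0_norm (f + g) <= C0_norm f + C0_norm g.
Proof.
rewrite -rmorphD lecR; apply: C0_sup_le => x.
by rewrite (le_trans (cnormD _ _))// lerD// C0_sup_ge.
Qed.

Let C0_supZ (c : R[i]) f : C0_sup (c *: f) = cnorm c * C0_sup f.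
Proof.
apply/eqP; rewrite eq_le; apply/andP; split.
  by apply: C0_sup_le => x; rewrite cnormM ler_wpM2l ?cnorm_ge0// C0_sup_ge.
have [->|c0] := eqVneq c 0; first by rewrite cnorm0 mul0r C0_sup_ge0.
have cc0 : 0 < cnorm c.
  by rewrite lt_neqAle cnorm_ge0 andbT eq_sym; apply: contra c0 => /eqP/cnorm0_eq0->.
rewrite mulrC -ler_pdivlMr//; apply: C0_sup_le => x.
by rewrite ler_pdivlMr// mulrC -cnormM; exact: (C0_sup_ge (c *: f)).
Qed.

Let C0_normZ (c : R[i]) f : C0_norm (c *: f) = `|c| * C0_norm f.
Proof. by rewrite /C0_norm C0_supZ rmorphM cnormE. Qed.

Let C0_norm0 f : C0_norm f = 0 -> f = 0.
Proof.
move=> /complexI f0; apply: C0_ext => x; apply: cnorm0_eq0.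
by apply/eqP; rewrite eq_le cnorm_ge0 andbT -f0 C0_sup_ge.
Qed.

HB.instance Definition _ :=
  Lmodule_isNormed.Build R[i] C0 C0_normD C0_normZ C0_norm0.

Lemma C0_normE (f : C0) : `|f| = (C0_sup f)%:C.
Proof. by []. Qed.

Let C0_complete (F : set_system C0) : ProperFilter F -> cauchy F -> cvg F.
Proof.
move=> FF /cauchy_ballP Fc.
have FC (e : R) : 0 < e -> \forall f & g \near F, C0_sup (f - g) < e.
  move=> e0; have : 0 < e%:C by rewrite ltcR.
  move=> /Fc; apply: filterS => -[f g].
  by rewrite /= -ball_normE /ball_ /= C0_normE ltcR.
have part (p : R[i] -> R) (pB : forall z z', p (z - z') = p z - p z')
    (pn : forall z, `|p z| <= cnorm z) (x : Ioc01) :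
    cvg ((fun f : C0 => p (f x)) @ F).
  apply: R_complete; apply/cauchy_ballP => e e0.
  have [[P Q] /= [FP FQ] PQ] := FC e e0.
  exists ((fun f : C0 => p (f x)) @` P, (fun f : C0 => p (f x)) @` Q).
    by split; [apply: filterS FP | apply: filterS FQ] => f Pf; exists f.
  move=> [_ _] /= [[f Pf <-] [g Qg <-]].
  rewrite -ball_normE /ball_ /= -pB (le_lt_trans (pn _))//.
  exact: le_lt_trans (C0_sup_ge (f - g) x) (PQ (f, g) (conj Pf Qg)).
have cre x := part (@complex.Re R) (fun z z' => raddfB _ z z') (@cnorm_ge_Re R) x.
have cim x := part (@complex.Im R) (fun z z' => raddfB _ z z') (@cnorm_ge_Im R) x.
pose l (x : Ioc01) : R[i]^o :=
  (lim ((fun f : C0 => complex.Re (f x)) @ F)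
   +i* lim ((fun f : C0 => complex.Im (f x)) @ F))%C.
have lP x (e : R) : 0 < e -> \forall f \near F, cnorm (l x - (f : C0) x) < e.
  move=> e0; have e2 : 0 < e / 2 by rewrite divr_gt0.
  have /cvgrPdist_lt/(_ _ e2) h1 := cre x.
  have /cvgrPdist_lt/(_ _ e2) h2 := cim x.
  apply: filterS2 h1 h2 => f h1 h2.
  rewrite (le_lt_trans (cnorm_le _))// [e]splitr ltrD//.
  - by move: h1; rewrite /l; case: (f x).
  - by move: h2; rewrite /l; case: (f x).
have lU (e : R) : 0 < e ->
    \forall f \near F, forall x, cnorm (l x - (f : C0) x) <= e.
  move=> e0; have e2 : 0 < e / 2 by rewrite divr_gt0.
  have [[P Q] /= [FP FQ] PQ] := FC _ e2.
  apply: filterS FP => f Pf x.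
  have [g [Qg gx]] := filter_ex (filterI FQ (lP x _ e2)).
  have -> : l x - f x = (l x - g x) - (f - g) x.
    by rewrite -[(f - g) x]/(f x - g x) opprB addrA subrK.
  rewrite (le_trans (cnormD _ _))// cnormN [e]splitr lerD ?ltW//.
  exact: le_lt_trans (C0_sup_ge (f - g) x) (PQ (f, g) (conj Pf Qg)).
have l0 : l \in C0_pred.
  apply: C0_predI => [x e e0|e e0].
    have e3 : 0 < e / 3 by rewrite divr_gt0.
    have [f hf] := filter_ex (lU _ e3).
    apply: filterS (C0_near f x e3) => y hy.
    have -> : l x - l y = (l x - f x) + ((f x - f y) - (l y - f y)).
      by rewrite opprB (addrA (f x - f y)) subrK addrA subrK.
    rewrite (le_lt_trans (cnormD _ _))//.
    have -> : e = e / 3 + (e / 3 + e / 3) by lra.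
    rewrite ler_ltD// (le_lt_trans (cnormD _ _))// cnormN.
    by rewrite ltr_leD.
  have e2 : 0 < e / 2 by rewrite divr_gt0.
  have [f hf] := filter_ex (lU _ e2).
  have [d d0 h] := C0_vanishing f e2; exists d => // x /h fx.
  have -> : l x = (l x - f x) + f x by rewrite subrK.
  by rewrite (le_lt_trans (cnormD _ _))// [e]splitr ler_ltD.
apply/cvg_ex; exists (MkC0 l0).
apply/cvgrPdist_le => _ /posc[e e0 ->].
apply: filterS (lU e e0) => f hf.
by rewrite C0_normE lecR; apply: C0_sup_le => x; exact: hf.
Qed.

HB.instance Definition _ := Uniform_isComplete.Build C0 C0_complete.

Let C0_mul_subproof (f g : C0) : (fun x => f x * g x) \in C0_pred.
Proof.
have [M hM] := C0_bounded f; have [N hN] := C0_bounded g.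
have M0 : 0 <= M := le_trans (cnorm_ge0 _) (hM pt1).
have N0 : 0 <= N := le_trans (cnorm_ge0 _) (hN pt1).
have M1 : 0 < M + 1 by rewrite ltr_wpDl.
have N1 : 0 < N + 1 by rewrite ltr_wpDl.
apply: C0_predI => [x e e0|e e0].
  have e1 : 0 < e / 2 / (M + 1) by rewrite !divr_gt0.
  have e2 : 0 < e / 2 / (N + 1) by rewrite !divr_gt0.
  apply: filterS2 (C0_near f x e2) (C0_near g x e1) => y hf hg.
  have -> : f x * g x - f y * g y
            = f x * (g x - g y) + (f x - f y) * g y.
    by rewrite mulrBr mulrBl addrA subrK.
  rewrite (le_lt_trans (cnormD _ _))// !cnormM [e]splitr ler_ltD//.
    rewrite (@le_trans _ _ ((M + 1) * cnorm (g x - g y)))//.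
      by rewrite ler_wpM2r ?cnorm_ge0// (le_trans (hM _))// lerDl.
    by rewrite mulrC -ler_pdivlMr// ltW.
  rewrite (@le_lt_trans _ _ (cnorm (f x - f y) * (N + 1)))//.
    by rewrite ler_wpM2l ?cnorm_ge0// (le_trans (hN _))// lerDl.
  by rewrite -ltr_pdivlMr.
have e1 : 0 < e / (M + 1) by rewrite !divr_gt0.
have [d d0 h] := C0_vanishing g e1; exists d => // x /h gx.
rewrite cnormM (@le_lt_trans _ _ ((M + 1) * cnorm (g x)))//.
  by rewrite ler_wpM2r ?cnorm_ge0// (le_trans (hM _))// lerDl.
by rewrite mulrC -ltr_pdivlMr.
Qed.

Definition C0_mul (f g : C0) : C0 := MkC0 (C0_mul_subproof f g).

Let C0_star_subproof (f : C0) : (fun x => Num.conj (f x)) \in C0_pred.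
Proof.
apply: C0_predI => [x e e0|e e0].
  by apply: filterS (C0_near f x e0) => y; rewrite -rmorphB cnormJ.
have [d d0 h] := C0_vanishing f e0; exists d => // x /h.
by rewrite cnormJ.
Qed.

Definition C0_star (f : C0) : C0 := MkC0 (C0_star_subproof f).

Let C0_mulA : associative C0_mul.
Proof. by move=> f g h; apply: C0_ext => x /=; rewrite mulrA. Qed.

Let C0_mulDl : left_distributive C0_mul +%R.
Proof. by move=> f g h; apply: C0_ext => x; exact: mulrDl. Qed.

Let C0_mulDr : right_distributive C0_mul +%R.
Proof. by move=> f g h; apply: C0_ext => x; exact: mulrDr. Qed.

Let C0_starK : involutive C0_star.
Proof. by move=> f; apply: C0_ext => x; exact: conjCK. Qed.

Let C0_starD : {morph C0_star : f g / f + g}.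
Proof. by move=> f g; apply: C0_ext => x; exact: rmorphD. Qed.

Let C0_starM f g : C0_star (C0_mul f g) = C0_mul (C0_star g) (C0_star f).
Proof. by apply: C0_ext => x; rewrite /= rmorphM mulrC. Qed.

HB.instance Definition _ := isStarRng.Build C0
  C0_mulA C0_mulDl C0_mulDr C0_starK C0_starD C0_starM.

Let C0_scaleAl (c : R[i]) (f g : C0) : c *: (f ** g) = (c *: f) ** g.
Proof. by apply: C0_ext => x; exact: mulrA. Qed.

Let C0_scaleAr (c : R[i]) (f g : C0) : c *: (f ** g) = f ** (c *: g).
Proof. by apply: C0_ext => x; exact: mulrCA. Qed.

Let C0_starZ (c : R[i]) (f : C0) : star (c *: f) = Num.conj c *: star f.
Proof. by apply: C0_ext => x; exact: rmorphM. Qed.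

Let C0_normM (f g : C0) : `|f ** g| <= `|f| * `|g|.
Proof.
rewrite !C0_normE -rmorphM lecR; apply: C0_sup_le => x.
by rewrite cnormM ler_pM ?cnorm_ge0// C0_sup_ge.
Qed.

Let C0_cstar (f : C0) : `|star f ** f| = `|f| ^+ 2.
Proof.
rewrite !C0_normE -rmorphXn; congr (_%:C); apply/eqP; rewrite eq_le.
apply/andP; split.
  apply: C0_sup_le => x; rewrite cnormM cnormJ -expr2.
  by rewrite lerXn2r ?nnegrE ?cnorm_ge0 ?C0_sup_ge0// C0_sup_ge.
rewrite -(@sqr_sqrtr _ (C0_sup (star f ** f))) ?C0_sup_ge0//.
rewrite lerXn2r ?nnegrE ?C0_sup_ge0 ?sqrtr_ge0//.
apply: C0_sup_le => x; rewrite -[leLHS]ger0_norm ?cnorm_ge0// -sqrtr_sqr.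
rewrite ler_wsqrtr// (le_trans _ (C0_sup_ge _ x))//.
by rewrite cnormM cnormJ -expr2.
Qed.

HB.instance Definition _ := isCStarAlgebra.Build R C0
  C0_scaleAl C0_scaleAr C0_starZ C0_normM C0_cstar.

Let C0_w_subproof : (fun x : Ioc01 => (val x)%:C) \in C0_pred.
Proof.
have cn (r : R) : cnorm r%:C = `|r|.
  by rewrite /cnorm normc_def /= expr0n addr0 sqrtr_sqr.
apply: C0_predI => [x e e0|e e0].
  have /cvgrPdist_lt/(_ e e0) := @initial_continuous Ioc01 R set_val x.
  by apply: filterS => y; rewrite -rmorphB cn.
exists e => // x xe; rewrite cn ger0_norm//.
by have := set_mem (valP x); rewrite /Ioc01 /= in_itv /= => /andP[/ltW].
Qed.

Definition C0_w : C0 := MkC0 C0_w_subproof.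

End C0.

(* Main.v *)
Require Import Defs.
From HB Require Import structures.
From mathcomp Require Import all_boot all_order all_algebra.
From mathcomp Require Import all_classical all_reals all_analysis.
From mathcomp Require Import complex ring lra.

Set Implicit Arguments.
Unset Strict Implicit.
Unset Printing Implicit Defensive.

Import Order.TTheory GRing.Theory Num.Theory.
Import numFieldNormedType.Exports.

Local Open Scope classical_set_scope.
Local Open Scope ring_scope.

(** The range of [Phi] is a subspace closed under triple products, so it is a
    subTRO containing [T a = Phi (w (x) a)] as soon as it is norm closed; and
    it lies in every subTRO [V] containing the range of [T] as soon as the
    preimage of [V] is everything.  Three facts are therefore needed.

    - TRO homomorphisms are bounded and have closed range ([TRO_hom_bounded],
      [TRO_hom_range_closed]).  The usual proofs go through the spectral theory
      and quotients of C*-algebras.  Here they rest on the single function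
      [s / (1 + i s^2)], applied to the singular values of an element [x]: its
      value is the solution [y] of [y + i x x^* y = x].  This equation is
      expressed by a triple product, hence preserved by TRO homomorphisms; it
      has a solution for every [x] ([resolvent_exists]), and any solution has
      norm at most 1 ([resolvent_nrm_le1]) since [1 - 2 i y x^*] is unitary,
      being the Cayley transform of [x x^*].  Solving it for [x] when [y] is
      small bounds [Phi]; solving it for [y] provides lifts of controlled norm
      of the elements of the range, whence closedness.

    - Elementary tensors are jointly continuous ([nrm_tensor_le]), and every
      element of [A] is a limit of triple products ([triple_approx]); both come
      from the same equation.

    - The closed subTRO of C_0((0,1]) generated by [w] is the whole algebra
      ([subTRO_w_full]).  It contains the products of [w] and a polynomial in
      [w^2]; approximating the square root on [0, 1] by Bernstein polynomials
      it contains [w^2] itself, hence all polynomials in [w^2] without constant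
      term, which are dense.

    The last two facts show that a subTRO containing all [w (x) a] contains
    all [f (x) a] ([tensor_generated]), and these span a dense subspace. *)

(** * A real-valued norm *)

Lemma cnorm_real (R : realType) (r : R) : cnorm r%:C%C = `|r|.
Proof. by rewrite /cnorm normc_def /= expr0n addr0 sqrtr_sqr. Qed.

Lemma conj_real (R : realType) (r : R) : Num.conj (r%:C%C : R[i]) = r%:C%C.
Proof. by apply/CrealP/complex_realP; exists r. Qed.

Section RealNorm.
Context (R : realType) (V : normedModType R[i]).
Implicit Types x y : V.

(** Norms of modules over [R[i]] take values in [R[i]], whose order is only
    partial; all estimates below are made with this real-valued copy. *)
Definition nrm x : R := complex.Re `|x|.

Lemma normE x : `|x| = (nrm x)%:C%C.
Proof.
rewrite /nrm -[LHS]normr_id cnormE /cnorm normr_id; exact: erefl.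
Qed.

Lemma nrm_ge0 x : 0 <= nrm x.
Proof. by rewrite -lecR -normE normr_ge0. Qed.

Lemma nrmD x y : nrm (x + y) <= nrm x + nrm y.
Proof. by rewrite -lecR rmorphD /= -!normE ler_normD. Qed.

Lemma nrmN x : nrm (- x) = nrm x.
Proof. by rewrite /nrm normrN. Qed.

Lemma nrmB x y : nrm (x - y) <= nrm x + nrm y.
Proof. by rewrite -(nrmN y) nrmD. Qed.

Lemma nrm_dist x y : nrm (x - y) = nrm (y - x).
Proof. by rewrite -nrmN opprB. Qed.

Lemma nrm_triangle z x y : nrm (x - y) <= nrm (x - z) + nrm (z - y).
Proof. by rewrite -[x - y](subrKA z) nrmD. Qed.

Lemma nrmZ (c : R[i]) x : nrm (c *: x) = cnorm c * nrm x.
Proof. by apply: complexI; rewrite -normE normrZ cnormE normE rmorphM. Qed.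

Lemma nrm0 : nrm (0 : V) = 0.
Proof. by rewrite /nrm normr0. Qed.

Lemma nrm_eq0 x : nrm x = 0 -> x = 0.
Proof. by move=> x0; apply/normr0_eq0; rewrite normE x0. Qed.

Lemma nrm_gt0 x : x != 0 -> 0 < nrm x.
Proof.
by move=> /eqP x0; rewrite lt_neqAle nrm_ge0 andbT eq_sym; apply/eqP => /nrm_eq0.
Qed.

Lemma nrmZr (r : R) x : 0 <= r -> nrm (r%:C%C *: x) = r * nrm x.
Proof. by move=> r0; rewrite nrmZ cnorm_real ger0_norm. Qed.

Lemma nrm_double x : nrm (x + x) = 2 * nrm x.
Proof.
rewrite -mulr2n -scaler_nat; have -> : 2%:R = (2 : R)%:C%C by rewrite rmorph_nat.
by rewrite nrmZr.
Qed.

Lemma nrmZi x : nrm ('i *: x) = nrm x.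
Proof. by rewrite nrmZ /cnorm normCi mul1r. Qed.

Lemma closed_nrm (X : set V) :
  closed X <->
  forall x, (forall e, 0 < e -> exists2 y, X y & nrm (x - y) < e) -> X x.
Proof.
split=> [cX x h|h].
  apply: cX => U /nbhs_ballP[_ /posc[e e0 ->] eU].
  have [y Xy xy] := h e e0; exists y; split=> //; apply: eU.
  by rewrite -ball_normE /ball_ /= normE ltcR.
move=> x cx; apply: h => e e0.
have [|y [Xy]] := cx (ball x e%:C%C); first by apply: nbhsx_ballx; rewrite ltcR.
by rewrite -ball_normE /ball_ /= normE ltcR => ?; exists y.
Qed.

End RealNorm.

Lemma le0_geometric (R : realType) (a C q : R) :
  0 <= q < 1 -> (forall n, a <= C * q ^+ n) -> a <= 0.
Proof.
move=> /andP[q0 q1] h.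
have : C * q ^+ n @[n --> \oo] --> C * 0.
  by apply: cvgMr; apply: cvg_expr; rewrite ger0_norm.
by rewrite mulr0 => /cvgr_to_ge; apply; near=> n; exact: h.
Unshelve. all: by end_near. Qed.

Section Complete.
Context (R : realType) (V : completeNormedModType R[i]).

(** The explicit rate is there to be combined with [le0_geometric], which turns
    estimates along the sequence into equalities at the limit. *)
Lemma complete_geometric (u : nat -> V) (C q : R) :
  0 <= q < 1 -> (forall n, nrm (u n.+1 - u n) <= C * q ^+ n) ->
  exists l, forall n, nrm (l - u n) <= C / (1 - q) * q ^+ n.
Proof.
move=> q01 h; have /andP[q0 q1] := q01.
have q1' : 0 < 1 - q by rewrite subr_gt0.
have C0 : 0 <= C.
  by have := h 0%N; rewrite expr0 mulr1; apply: le_trans (nrm_ge0 _).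
set K := C / (1 - q); have K0 : 0 <= K by rewrite divr_ge0 // ltW.
have CK : C = K * (1 - q) by rewrite /K mulfVK ?gt_eqF.
have tail n m : nrm (u (n + m)%N - u n) <= K * q ^+ n.
  suff: nrm (u (n + m)%N - u n) <= K * q ^+ n * (1 - q ^+ m).
    move=> /le_trans; apply; apply: ler_piMr.
      by rewrite mulr_ge0 ?exprn_ge0.
    by rewrite lerBlDr lerDl exprn_ge0.
  elim: m => [|m IH]; first by rewrite addn0 subrr nrm0 expr0 subrr mulr0.
  rewrite addnS (le_trans (nrm_triangle (u (n + m)%N) _ _)) //.
  apply: le_trans (lerD (h _) IH) _; rewrite CK exprD exprS le_eqVlt.
  by apply/orP; left; apply/eqP; ring.
have small e : 0 < e -> exists n, K * q ^+ n < e.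
  move=> e0; apply: contrapT => /forallNP N; move: e0; apply/negP.
  rewrite -leNgt; apply: (le0_geometric q01 (C := K)) => n.
  by rewrite leNgt; apply/negP/N.
have : cauchy (u @ \oo).
  apply: cauchy_exP => _ /posc[e e0 ->]; have [N hN] := small e e0.
  exists (u N); exists N => // n /= /subnKC <-.
  rewrite -ball_normE /ball_ /= normE ltcR nrm_dist.
  exact: le_lt_trans (tail _ _) hN.
move=> /cauchy_cvgP /cvg_ex[l /cvgrPdist_lt ul]; exists l => n.
apply/ler_addgt0Pl => e e0; have : 0 < e%:C%C by rewrite ltcR.
move=> /ul[m _ hm]; have := hm (n + m)%N (leq_addl _ _).
rewrite normE ltcR => /ltW hnm.
exact: le_trans (nrm_triangle (u (n + m)%N) _ _) (lerD hnm (tail _ _)).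
Qed.

Lemma contraction_fixed_point (f : V -> V) (U : set V) (q : R) (x0 : V) :
  0 <= q < 1 -> closed U -> U x0 -> (forall x, U x -> U (f x)) ->
  (forall x y, U x -> U y -> nrm (f x - f y) <= q * nrm (x - y)) ->
  exists2 x, U x & f x = x.
Proof.
move=> q01 cU U0 fU fq; have /andP[q0 q1] := q01; pose u n := iter n f x0.
have Uu n : U (u n) by elim: n => //= n; exact: fU.
have step n : nrm (u n.+1 - u n) <= nrm (f x0 - x0) * q ^+ n.
  elim: n => [|n IH]; first by rewrite expr0 mulr1.
  apply: le_trans (fq _ _ (Uu n.+1) (Uu n)) _.
  by rewrite exprS mulrCA ler_wpM2l.
have [l] := complete_geometric q01 step; set K := _ / _ => ul.
have Ul : U l.
  apply: ((closed_nrm U).1 cU) => e e0; apply: contrapT => N.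
  move: e0; apply/negP; rewrite -leNgt.
  apply: (le0_geometric q01 (C := K)) => n.
  rewrite leNgt; apply/negP => ne; apply: N; exists (u n) => //.
  exact: le_lt_trans (ul n) ne.
exists l => //; apply/subr0_eq/nrm_eq0/le_anti; rewrite nrm_ge0 andbT.
apply: (le0_geometric q01 (C := 2 * K * q)) => n.
have h1 : nrm (f l - f (u n)) <= K * q ^+ n.+1.
  apply: le_trans (fq _ _ Ul (Uu n)) _.
  by rewrite exprS mulrCA ler_wpM2l.
have h2 := ul n.+1; rewrite nrm_dist in h2.
apply: le_trans (nrm_triangle (f (u n)) _ _) _.
apply: le_trans (lerD h1 h2) _; rewrite exprS le_eqVlt.
by apply/orP; left; apply/eqP; ring.
Qed.

End Complete.

Section CStarBasics.
Context (R : realType) (A : cstarAlgType R).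
Implicit Types x y z : A.

Lemma smulZl (c : R[i]) x y : (c *: x) ** y = c *: (x ** y).
Proof. by rewrite scale_smulAl. Qed.

Lemma smulZr (c : R[i]) x y : x ** (c *: y) = c *: (x ** y).
Proof. by rewrite scale_smulAr. Qed.

Lemma smulNl x y : (- x) ** y = - (x ** y).
Proof. by rewrite -scaleN1r smulZl scaleN1r. Qed.

Lemma smulNr x y : x ** (- y) = - (x ** y).
Proof. by rewrite -scaleN1r smulZr scaleN1r. Qed.

Lemma smulBl x y z : (x - y) ** z = x ** z - y ** z.
Proof. by rewrite smulDl smulNl. Qed.

Lemma smulBr x y z : x ** (y - z) = x ** y - x ** z.
Proof. by rewrite smulDr smulNr. Qed.

Lemma nrmM x y : nrm (x ** y) <= nrm x * nrm y.
Proof. by rewrite -lecR rmorphM /= -!normE norm_smul_le. Qed.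

Lemma nrm_starM x : nrm (star x ** x) = nrm x ^+ 2.
Proof. by apply: complexI; rewrite -normE cstar_identity normE rmorphXn. Qed.

Lemma nrm_star x : nrm (star x) = nrm x.
Proof.
suff le y : nrm y <= nrm (star y) by apply/le_anti; rewrite le /= -{2}[x]starK le.
have := nrmM (star y) y; rewrite nrm_starM expr2.
have := nrm_ge0 y; rewrite le_eqVlt => /orP[/eqP <- _|y0]; first exact: nrm_ge0.
by rewrite ler_pM2r.
Qed.

Lemma nrm_Mstar x : nrm (x ** star x) = nrm x ^+ 2.
Proof. by rewrite -{1}[x]starK nrm_starM nrm_star. Qed.

Lemma starB x y : star (x - y) = star x - star y.
Proof. by rewrite starD -scaleN1r starZ rmorphN rmorph1 scaleN1r. Qed.

Lemma starZi x : star ('i *: x) = - ('i *: star x).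
Proof. by rewrite starZ conjCi scaleNr. Qed.

Lemma scaleii x : 'i *: ('i *: x) = - x.
Proof. by rewrite scalerA -expr2 sqrCi scaleN1r. Qed.

End CStarBasics.

(** * The Cayley transform and resolvents *)

(** [j] stands for a left multiplication or for a map such as [a |-> f (x) a]:
    the hypothesis [js] says that inner products of values of [j] depend only
    on the inner products [star z ** z'] in [A], so that left multiplications
    of [A] act on the range of [j] as adjointable operators.  Working at this
    generality gives at once bounds for the norm of [A] (with [j] the
    identity) and for the norm of elementary tensors. *)
Section Cayley.
Context (R : realType) (A D : cstarAlgType R).
Variables (j : {linear A -> D}) (s : A -> D).
Hypothesis js : forall z z', star (j z) ** j z' = s (star z ** z').

Lemma nrm_eq_gram z z' : star z ** z = star z' ** z' -> nrm (j z) = nrm (j z').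
Proof.
move=> zz; apply/eqP; rewrite -(@eqrXn2 _ 2) ?nrm_ge0 //.
by rewrite -!nrm_starM !js zz.
Qed.

(** For self-adjoint [h], both [1 + i h] and [1 - i h] have square modulus
    [1 + h^2]; their quotient is the Cayley transform of [h], a unitary. *)
Lemma nrm_cayley h z : star h = h ->
  nrm (j (z + 'i *: (h ** z))) = nrm (j (z - 'i *: (h ** z))).
Proof.
move=> hh; apply: nrm_eq_gram; have e : star (h ** z) ** z = star z ** (h ** z).
  by rewrite starM hh smulA.
rewrite starB starD !starZi !smulDl !smulDr !smulNl !smulNr !smulZl !smulZr.
rewrite !opprK e.
by rewrite !addrA addrK subrK.
Qed.

Lemma le_nrm_cayley h z : star h = h ->
  nrm (j z) <= nrm (j (z + 'i *: (h ** z))).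
Proof.
move=> hh; have e : j z + j z = j (z + 'i *: (h ** z)) + j (z - 'i *: (h ** z)).
  by rewrite -!linearD /= addrACA subrr addr0.
have := nrmD (j (z + 'i *: (h ** z))) (j (z - 'i *: (h ** z))).
by rewrite -e nrm_double -nrm_cayley // mulr_natl mulr2n; lra.
Qed.

Lemma le_nrm_cayley_mul h z : star h = h ->
  nrm (j (h ** z)) <= nrm (j (z + 'i *: (h ** z))).
Proof.
move=> hh; rewrite -[leLHS]nrmZi -linearZ /=.
set y := 'i *: (h ** z).
have e : j y + j y = j (z + y) - j (z - y).
  by rewrite -linearB -linearD /= opprB [in RHS]addrC addrA subrK.
have := nrmB (j (z + y)) (j (z - y)).
by rewrite -e nrm_double /y -nrm_cayley // mulr_natl mulr2n; lra.
Qed.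

(** Here [y = (1 + i x x^* )^-1 x].  The bound does not depend on the norm of
    [x], because the function [r / (1 + i r^2)] is bounded on the line.  With
    [h = x x^*], the element [k = y x^*] is [h (1 + i h)^-1], a contraction
    because [1 - 2 i k] is the Cayley transform of [h]; then
    [y y^* = (1 + i h)^-1 k^*] is a contraction too, hence so is [y^*]. *)
Lemma nrm_resolvent_le x y z : y + 'i *: (x ** star x ** y) = x ->
  nrm (j (star y ** z)) <= nrm (j z).
Proof.
move=> yx; set h := x ** star x; set k := y ** star x.
have hh : star h = h by rewrite /h starM starK.
have kh : k + 'i *: (h ** k) = h.
  by rewrite /k smulA -smulZl -smulDl yx.
have kle u : nrm (j (k ** u)) <= nrm (j u).
  (* m = (1 + i h)^-1 u *)
  pose m := u - 'i *: (k ** u).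
  have hm : h ** m = k ** u.
    by rewrite /m smulBr smulZr -{1}kh smulDl smulZl -(smulA h) addrK.
  have mu : m + 'i *: (h ** m) = u by rewrite hm subrK.
  by rewrite -hm -[in leRHS]mu le_nrm_cayley_mul.
have gram u c :
    nrm (j (star c ** u)) ^+ 2 <= nrm (j u) * nrm (j (c ** star c ** u)).
  rewrite -nrm_starM js starM starK -smulA (smulA c) -js.
  by rewrite (le_trans (nrmM _ _)) // nrm_star.
have sq_le (a b : R) : 0 <= a -> 0 <= b -> a ^+ 2 <= b * b -> a <= b.
  by move=> a0 b0; rewrite -expr2 ler_pXn2r.
have ksle u : nrm (j (star k ** u)) <= nrm (j u).
  have := gram u k; rewrite -(smulA k).
  move=> /le_trans/(_ (ler_wpM2l (nrm_ge0 _) (kle _))).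
  have := nrm_ge0 (j (star k ** u)).
  rewrite le_eqVlt => /orP[/eqP <- _|p]; first exact: nrm_ge0.
  by rewrite expr2 ler_pM2r.
apply: sq_le => //; try exact: nrm_ge0.
apply: le_trans (gram _ _) _; rewrite ler_wpM2l ?nrm_ge0 //.
apply: le_trans (ksle z); apply: le_trans (le_nrm_cayley _ hh) _.
rewrite (smulA h) (smulA h) -smulZl -smulDl -smulZl -smulDl yx.
by rewrite /k starM starK.
Qed.

End Cayley.

Lemma resolvent_nrm_le1 (R : realType) (A : cstarAlgType R) (x y : A) :
  y + 'i *: (x ** star x ** y) = x -> nrm y <= 1.
Proof.
move=> /(@nrm_resolvent_le _ A A idfun id (fun _ _ => erefl) _ _ y).
rewrite /= nrm_starM; have := nrm_ge0 y; rewrite le_eqVlt => /orP[/eqP <- //|p].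
by rewrite expr2 ger_pMr.
Qed.

(** Two equations between [x] and [y = (1 + i x x^* )^-1 x] are solved by
    iteration: for [y], given any [x], and for [x], given a small [y]. *)
Section FixedPoints.
Context (R : realType) (A : cstarAlgType R).

Lemma nrm_shift_le (N : R) (h d : A) : star h = h -> 0 <= N ->
  nrm (N%:C%C *: d - 'i *: (h ** d)) ^+ 2 <= (N ^+ 2 + nrm h ^+ 2) * nrm d ^+ 2.
Proof.
move=> hh N0; rewrite -nrm_starM.
have e : star (h ** d) ** d = star d ** (h ** d) by rewrite starM hh smulA.
have -> : star (N%:C%C *: d - 'i *: (h ** d)) **
          (N%:C%C *: d - 'i *: (h ** d)) =
    N%:C%C *: (N%:C%C *: (star d ** d)) + star (h ** d) ** (h ** d).
  rewrite starB starZi starZ conj_real opprK smulDl !smulBr !smulZl !smulZr.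
  rewrite e scaleii.
  by rewrite opprK addrA (scalerA 'i) (scalerA N%:C%C 'i) (mulrC 'i) subrK.
apply: le_trans (nrmD _ _) _.
rewrite !nrmZr // !nrm_starM mulrDl expr2 -mulrA lerD2l.
by rewrite -exprMn lerXn2r ?nnegrE ?mulr_ge0 ?nrm_ge0 // nrmM.
Qed.

(** Self-adjoint elements have real spectrum.  The classical trick is to shift
    by a large imaginary number: [1 + i h = (N + 1) + i (h + i N)], and
    [|h + i N|^2 <= |h|^2 + N^2] is less than [(N + 1)^2], so that the equation
    is a fixed point problem for a contraction. *)
Lemma cayley_surjective (h z : A) : star h = h ->
  exists m, m + 'i *: (h ** m) = z.
Proof.
move=> hh.
(* any N with nrm h ^+ 2 <= N + 1/4 gives |h + i N| <= N + 1/2 *)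
pose N := nrm h ^+ 2; have N0 : 0 <= N by rewrite sqr_ge0.
have r0 : 0 < N + 1 by rewrite ltr_wpDl.
have ri : 0 <= (N + 1)^-1 by rewrite invr_ge0 ltW.
pose f m : A := (N + 1)^-1%:C%C *: (z + (N%:C%C *: m - 'i *: (h ** m))).
pose q := (N + 2^-1) / (N + 1).
have [| | | |x y _ _|m _ fm] := @contraction_fixed_point R A f setT q 0.
- rewrite /q divr_ge0 ?addr_ge0 //= ?invr_ge0 // ltr_pdivrMr // mul1r ltrD2l.
  by rewrite invf_lt1 // ltr1n.
- exact: closedT.
- by [].
- by [].
- rewrite /f -scalerBr opprD addrACA subrr add0r.
  rewrite (nrmZr _ ri) [leRHS]mulrAC [leLHS]mulrC ler_wpM2r //.
  have -> : N%:C%C *: x - 'i *: (h ** x) - (N%:C%C *: y - 'i *: (h ** y)) =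
            N%:C%C *: (x - y) - 'i *: (h ** (x - y)).
    by rewrite smulBr !scalerBr !opprD !opprK addrACA.
  rewrite -(@ler_pXn2r _ 2) ?nnegrE ?mulr_ge0 ?addr_ge0 ?nrm_ge0 ?invr_ge0 //.
  apply: le_trans (nrm_shift_le _ hh N0) _.
  rewrite [leRHS]exprMn ler_wpM2r ?sqr_ge0 //.
  by rewrite -[nrm h ^+ 2]/N; nra.
exists m; have : (N + 1)%:C%C *: f m = (N + 1)%:C%C *: m by rewrite fm.
rewrite /f scalerA -rmorphM /= divff ?gt_eqF // rmorph1 scale1r.
rewrite rmorphD /= rmorph1.
rewrite scalerDl scale1r (addrC (_ *: m)) addrA.
move=> /(congr1 (fun v => v - N%:C%C *: m)).
by rewrite addrK (addrC (N%:C%C *: m)) addrK => /(canRL (subrK _)) ->.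
Qed.

Lemma resolvent_exists (x : A) : exists y, y + 'i *: (x ** star x ** y) = x.
Proof. by apply: cayley_surjective; rewrite starM starK. Qed.

Lemma inverse_resolvent_exists (x : A) : nrm x <= 4^-1 ->
  exists y, x + 'i *: (y ** star y ** x) = y.
Proof.
move=> x4; pose f y : A := x + 'i *: (y ** star y ** x).
pose U : set A := [set y | nrm y <= 2^-1].
have [| | | | |y _ fy] := @contraction_fixed_point R A f U 2^-1 0;
  last by exists y.
- by rewrite invr_ge0 ler0n invf_lt1 // ltr1n.
- apply/closed_nrm => y hy; rewrite /U /=; apply/ler_addgt0Pl => e /hy[v Uv yv].
  rewrite -(subrK v y) (le_trans (nrmD _ _)) // lerD //; exact: ltW.
- by rewrite /U /= nrm0 invr_ge0.
- move=> y; rewrite /U /f /= => Uy; apply: le_trans (nrmD _ _) _; rewrite nrmZi.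
  have h1 := nrmM (y ** star y) x; rewrite nrm_Mstar in h1.
  have := nrm_ge0 x; have := nrm_ge0 y; nra.
- move=> y z Uy Uz; rewrite /f opprD addrACA subrr add0r -scalerBr nrmZi -smulBl.
  have -> : y ** star y - z ** star z = (y - z) ** star y + z ** star (y - z).
    by rewrite starB smulBl smulBr addrA subrK.
  rewrite smulDl; apply: le_trans (nrmD _ _) _.
  have a1 := nrmM ((y - z) ** star y) x; have a2 := nrmM (z ** star (y - z)) x.
  have b1 := nrmM (y - z) (star y); have b2 := nrmM z (star (y - z)).
  rewrite !nrm_star in b1 b2; rewrite /U /= in Uy Uz.
  have d0 := nrm_ge0 (y - z); have x2 : nrm x <= 2^-1 by lra.
  have c1 : nrm (y - z) * nrm y * nrm x <= nrm (y - z) * 2^-1 * 2^-1.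
    by do 2![apply: ler_pM; rewrite ?mulr_ge0 ?nrm_ge0 //].
  have c2 : nrm z * nrm (y - z) * nrm x <= 2^-1 * nrm (y - z) * 2^-1.
    by do 2![apply: ler_pM; rewrite ?mulr_ge0 ?nrm_ge0 //].
  have e1 := ler_wpM2r (nrm_ge0 x) b1; have e2 := ler_wpM2r (nrm_ge0 x) b2.
  lra.
Qed.

End FixedPoints.

(** * Triple products and TRO homomorphisms *)

Section TROHomomorphisms.
Context (R : realType).

(** For [y = (1 + i r^2 a a^* )^-1 r a] the difference [a - y / r] is the
    triple product of [a], [a] and [i r y], while [y / r] is small for large
    [r] since [y] is bounded. *)
Lemma triple_approx (A : cstarAlgType R) (a : A) (e : R) : 0 < e ->
  exists b, nrm (a - triple a a b) < e.
Proof.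
move=> e0; pose r := 2 / e; have r0 : 0 < r by rewrite divr_gt0.
have [y yE] := resolvent_exists (r%:C%C *: a).
exists ('i *: (r%:C%C *: y)).
have y1 := resolvent_nrm_le1 yE.
suff -> : a - triple a a ('i *: (r%:C%C *: y)) = r^-1%:C%C *: y.
  have ri : r^-1 = e / 2 by rewrite /r invf_div.
  rewrite nrmZr ri ?divr_ge0 ?(ltW e0) //; have := nrm_ge0 y; nra.
have rr : (r^-1%:C%C * r%:C%C : R[i]) = 1.
  by rewrite -rmorphM /= mulVf ?gt_eqF // rmorph1.
have aE : a = r^-1%:C%C *: y + 'i *: (r%:C%C *: (a ** star a ** y)).
  have {1}-> : a = r^-1%:C%C *: (r%:C%C *: a) by rewrite scalerA rr scale1r.
  rewrite -{1}yE scalerDr starZ conj_real !(smulZl, smulZr) !scalerA.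
  by rewrite -!mulrA (mulrCA _ 'i) (mulrA r^-1%:C%C) rr mul1r.
by rewrite {1}aE /triple !smulZr addrK.
Qed.

Section Hom.
Variables (D B : cstarAlgType R) (Phi : {linear D -> B}).
Hypothesis Phi_TRO : TRO_hom Phi.

(** Automatic continuity: a small [x] is [(1 + i y y^* )^-1 y] for some [y],
    and a TRO homomorphism carries this equation to the range, where it forces
    [nrm (Phi x) <= 1]. *)
Lemma TRO_hom_bounded x : nrm (Phi x) <= 4 * nrm x.
Proof.
have [->|x0] := eqVneq x 0; first by rewrite linear0 !nrm0 mulr0.
have n0 : 0 < nrm x by apply: nrm_gt0.
pose r := (4 * nrm x)^-1; have r0 : 0 < r by rewrite invr_gt0 mulr_gt0.
have [|y yE] := @inverse_resolvent_exists R D (r%:C%C *: x).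
  rewrite (nrmZr _ (ltW r0)) /r invfM mulfVK ?gt_eqF //.
have : nrm (Phi (r%:C%C *: x)) <= 1.
  apply: (@resolvent_nrm_le1 _ _ (Phi y)); rewrite -[RHS]/(Phi y) -[in RHS]yE.
  by rewrite linearD [Phi ('i *: _)]linearZ /= [Phi (_ ** _)]Phi_TRO.
rewrite linearZ /= (nrmZr _ (ltW r0)) /r mulrC.
by rewrite ler_pdivrMr ?mulr_gt0 // mul1r.
Qed.

(** An element [Phi x] of norm [1/2] is close to its image under the function
    [s / (1 + i s^2)], which lifts to [y = (1 + i x x^* )^-1 x]: the norm of
    [y] is at most 1 even when that of [x] is large. *)
Lemma TRO_hom_approx_lift b : range Phi b ->
  exists2 y, nrm y <= 2 * nrm b & nrm (b - Phi y) <= 2^-1 * nrm b.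
Proof.
move=> [x _ <-] {b}; have [b0|b0] := eqVneq (Phi x) 0.
  by exists 0; [rewrite nrm0 b0 nrm0 mulr0 | rewrite raddf0 subr0 b0 nrm0 mulr0].
have n0 : 0 < nrm (Phi x) by apply: nrm_gt0.
pose r := (2 * nrm (Phi x))^-1; have r0 : 0 < r by rewrite invr_gt0 mulr_gt0.
have rE : r^-1 = 2 * nrm (Phi x) by rewrite invrK.
have ri0 : 0 <= r^-1 by rewrite invr_ge0 ltW.
have [y yE] := resolvent_exists (r%:C%C *: x).
have ybE : Phi y + 'i *: (Phi (r%:C%C *: x) ** star (Phi (r%:C%C *: x)) ** Phi y)
    = Phi (r%:C%C *: x).
  by rewrite -[in RHS]yE linearD [Phi ('i *: _)]linearZ /= [Phi (_ ** _)]Phi_TRO.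
have y1 := resolvent_nrm_le1 yE; have b1 := resolvent_nrm_le1 ybE.
have bn : nrm (Phi (r%:C%C *: x)) = 2^-1.
  by rewrite linearZ /= (nrmZr _ (ltW r0)) /r invfM mulfVK ?gt_eqF.
have d4 : nrm (Phi (r%:C%C *: x) - Phi y) <= 4^-1.
  rewrite -{1}ybE addrC addKr nrmZi; apply: le_trans (nrmM _ _) _.
  rewrite nrm_Mstar bn; have := nrm_ge0 (Phi y); nra.
exists (r^-1%:C%C *: y); first by rewrite (nrmZr _ ri0) rE; nra.
have -> : Phi x - Phi (r^-1%:C%C *: y) =
          r^-1%:C%C *: (Phi (r%:C%C *: x) - Phi y).
  rewrite scalerBr -!linearZ /= scalerA -rmorphM /= divff ?gt_eqF //.
  by rewrite rmorph1 scale1r.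
by rewrite (nrmZr _ ri0) rE; nra.
Qed.

(** As in the proof of the open mapping theorem, approximate lifts of bounded
    norm of the successive remainders are summed. *)
Lemma TRO_hom_range_closed : closed (range Phi).
Proof.
pose cl := closure (range Phi).
(* the lift of a nearby b' in the range, at distance nrm b / 4 *)
have lift b : exists y,
    cl b -> nrm y <= 3 * nrm b /\ nrm (b - Phi y) <= 7 / 8 * nrm b.
  have [clb|] := pselect (cl b); last by exists 0.
  have [->|b0] := eqVneq b 0.
    by exists 0; rewrite raddf0 subr0 !nrm0 !mulr0.
  have n0 : 0 < nrm b by apply: nrm_gt0.
  have e0 : 0 < (nrm b / 4)%:C%C :> R[i] by rewrite ltcR divr_gt0.
  have [b' [rb']] := clb _ (nbhsx_ballx b _ e0).
  rewrite -ball_normE /ball_ /= normE ltcR => bb'.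
  have [y y2 yb] := TRO_hom_approx_lift rb'; exists y => _.
  have h1 := nrm_triangle b b' 0; have h2 := nrm_triangle b' b (Phi y).
  rewrite !subr0 (nrm_dist b' b) in h1.
  by split; lra.
have [g gP] := choice lift.
move=> b clb.
pose x := fix x n := if n is m.+1 then x m + g (b - Phi (x m)) else 0 : D.
have xS n : x n.+1 = x n + g (b - Phi (x n)) by [].
have clx n : cl (b - Phi (x n)).
  move=> U /nbhs_ballP[_ /posc[e e0 ->] eU].
  have [|c [[d _ <-]]] := clb (ball b e%:C%C).
    by apply: nbhsx_ballx; rewrite ltcR.
  rewrite -ball_normE /ball_ /= => bc; exists (Phi (d - x n)).
  split; first by exists (d - x n).
  by apply: eU; rewrite -ball_normE /ball_ /= raddfB opprB addrA subrK.
have bn n : nrm (b - Phi (x n)) <= nrm b * (7 / 8) ^+ n.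
  elim: n => [|n IH]; first by rewrite raddf0 subr0 expr0 mulr1.
  rewrite xS raddfD opprD addrA; have [_ /le_trans] := gP _ (clx n); apply.
  by rewrite exprS mulrCA ler_wpM2l.
have step n : nrm (x n.+1 - x n) <= 3 * nrm b * (7 / 8) ^+ n.
  rewrite xS addrC addKr; have [/le_trans + _] := gP _ (clx n); apply.
  by rewrite -mulrA ler_wpM2l.
have q01 : 0 <= (7 / 8 : R) < 1 by lra.
have [l lx] := complete_geometric q01 step; exists l => //.
apply: esym; apply: subr0_eq; apply: nrm_eq0; apply: le_anti.
rewrite nrm_ge0 andbT.
set K := 3 * _ / _ in lx; apply: (le0_geometric q01 (C := nrm b + 4 * K)) => n.
apply: le_trans (nrm_triangle (Phi (x n)) _ _) _; rewrite mulrDl lerD //.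
rewrite -raddfB; apply: le_trans (TRO_hom_bounded _) _.
by rewrite nrm_dist -mulrA ler_wpM2l // lx.
Qed.

End Hom.
End TROHomomorphisms.

(** * Continuity of elementary tensors *)

Section MultiplierBound.
Context (R : realType) (A D : cstarAlgType R).
Variables (j : {linear A -> D}) (s : A -> D).
Hypothesis js : forall z z', star (j z) ** j z' = s (star z ** z').

(** After scaling, [star b] is [(1 + i x x^* )^-1 x] for some [x], so that
    [nrm_resolvent_le] applies to it. *)
Lemma nrm_mul_le b z : nrm (j (b ** z)) <= 4 * nrm b * nrm (j z).
Proof.
have [->|/nrm_gt0 b0] := eqVneq b 0.
  by rewrite smul0r raddf0 !nrm0 mulr0 mul0r.
pose r := (4 * nrm b)^-1; have r0 : 0 < r by rewrite invr_gt0 mulr_gt0.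
have [|x xE] := @inverse_resolvent_exists R A (r%:C%C *: star b).
  by rewrite (nrmZr _ (ltW r0)) nrm_star /r invfM mulfVK ?gt_eqF.
have := nrm_resolvent_le js z xE.
rewrite starZ conj_real starK smulZl linearZ /= (nrmZr _ (ltW r0)) /r mulrC.
by rewrite ler_pdivrMr ?mulr_gt0 // mulrC.
Qed.

End MultiplierBound.

Section TensorBound.
Context (R : realType) (A B D : cstarAlgType R) (t : A -> B -> D).
Hypothesis t_tensor : cstar_tensor_product t.

Lemma tensor_linearl b : linear (t^~ b).
Proof. by case: t_tensor => -[h _] _ _ _ c u v; exact: h. Qed.

Lemma tensor_linearr a : linear (t a).
Proof. by case: t_tensor => -[_ h] _ _ _ c u v; exact: h. Qed.

Lemma tensorBl a a' b : t (a - a') b = t a b - t a' b.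
Proof. by rewrite addrC -scaleN1r (tensor_linearl b) scaleN1r addrC. Qed.

Lemma tensorBr a b b' : t a (b - b') = t a b - t a b'.
Proof. by rewrite addrC -scaleN1r (tensor_linearr a) scaleN1r addrC. Qed.

Lemma tensor_mul a b a' b' : t a b ** t a' b' = t (a ** a') (b ** b').
Proof. by case: t_tensor => _ h _ _; case: (h a a' b b'). Qed.

Lemma tensor_star a b : star (t a b) = t (star a) (star b).
Proof. by case: t_tensor => _ h _ _; case: (h a a b b). Qed.

(** The norm of [t a b] squared is that of [t (a^* a) (b^* b)]; there, by
    [nrm_mul_le], the left factors [a^*] and [b^*] can be taken out one at a
    time, which leaves one factor [nrm (t a b)] to cancel.  (The optimal
    constant is 1, but any constant gives continuity.) *)
Lemma nrm_tensor_le a b : nrm (t a b) <= 16 * nrm a * nrm b.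
Proof.
pose tl : {linear A -> D} :=
  HB.pack (t^~ (star b ** b))
    (GRing.isLinear.Build _ _ _ _ _ (tensor_linearl (star b ** b))).
pose tr : {linear B -> D} :=
  HB.pack (t a) (GRing.isLinear.Build _ _ _ _ _ (tensor_linearr a)).
have hl :
    nrm (t (star a ** a) (star b ** b)) <= 4 * nrm a * nrm (t a (star b ** b)).
  pose s := t^~ (star (star b ** b) ** (star b ** b)).
  rewrite -(nrm_star a); apply: (@nrm_mul_le _ _ _ tl s).
  by move=> z z'; rewrite /s /= tensor_star tensor_mul.
have hr : nrm (t a (star b ** b)) <= 4 * nrm b * nrm (t a b).
  rewrite -(nrm_star b); apply: (@nrm_mul_le _ _ _ tr (t (star a ** a))).
  by move=> z z'; rewrite /= tensor_star tensor_mul.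
have e : nrm (t a b) ^+ 2 = nrm (t (star a ** a) (star b ** b)).
  by rewrite -nrm_starM tensor_star tensor_mul.
have := nrm_ge0 (t a b); rewrite le_eqVlt => /orP[/eqP <-|p].
  by rewrite !mulr_ge0 ?nrm_ge0.
rewrite -(ler_pM2r p) -expr2 e; apply: le_trans hl _.
have -> : 16 * nrm a * nrm b * nrm (t a b) =
          4 * nrm a * (4 * nrm b * nrm (t a b)) by ring.
by rewrite ler_wpM2l // mulr_ge0 ?nrm_ge0.
Qed.

End TensorBound.

(** * Bernstein approximation *)

Section Bernstein.

(** [\sum_k 'C(n, k) phi k x^k (1 - x)^(n - k)], as the expected value of
    [phi] at the number of successes in [n] independent trials, computed by
    conditioning on one trial: the moments, the positivity and the membership
    in a given space then follow by immediate inductions. *)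
Fixpoint bernstein (K : pzRingType) (n : nat) (phi : nat -> K) (x : K) : K :=
  if n is m.+1 then
    x * bernstein m (phi \o succn) x + (1 - x) * bernstein m phi x
  else phi 0%N.

Lemma bernstein_comb (K : comPzRingType) n (a b : K) (phi psi : nat -> K) x :
  bernstein n (fun k => a * phi k + b * psi k) x =
  a * bernstein n phi x + b * bernstein n psi x.
Proof.
elim: n phi psi => //= n IH phi psi.
rewrite (IH phi psi) (IH (phi \o succn) (psi \o succn)); ring.
Qed.

Lemma bernstein_cst (K : pzRingType) n (c x : K) : bernstein n (fun=> c) x = c.
Proof.
by elim: n => //= n IH; rewrite [X in x * X]IH IH -mulrDl addrC subrK mul1r.
Qed.

(** The variance of the number of successes; a general centre [y] is what the
    induction needs. *)
Lemma bernstein_sqr (K : comPzRingType) n (x y : K) :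
  bernstein n (fun k => (k%:R - y) ^+ 2) x =
  n%:R * x * (1 - x) + (n%:R * x - y) ^+ 2.
Proof.
elim: n y => [|n IH] y /=; first by ring.
rewrite IH; have -> : bernstein n ((fun k => (k%:R - y) ^+ 2) \o succn) x =
    bernstein n (fun k => (k%:R - (y - 1)) ^+ 2) x.
  congr (bernstein n _ x); apply/funext => k /=.
  by rewrite -natr1; congr (_ ^+ 2); ring.
rewrite IH -natr1; ring.
Qed.

Context (R : realType).

Lemma cnorm_bernstein_le n (phi : nat -> R[i]) (psi : nat -> R) (x : R) :
  0 <= x <= 1 -> (forall k, (k <= n)%N -> cnorm (phi k) <= psi k) ->
  cnorm (bernstein n phi x%:C%C) <= bernstein n psi x.
Proof.
move=> /andP[x0 x1]; elim: n phi psi => [|n IH] phi psi h /=; first exact: h.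
apply: le_trans (cnormD _ _) _; rewrite !cnormM.
have -> : 1 - x%:C%C = (1 - x)%:C%C :> R[i] by rewrite rmorphB rmorph1.
rewrite !cnorm_real !ger0_norm ?subr_ge0 //; apply: lerD.
  by rewrite ler_wpM2l // IH // => k kn; exact: h.
by rewrite ler_wpM2l ?subr_ge0 // IH // => k kn; exact/h/leqW.
Qed.

(** Stating the modulus of continuity with a quadratic error term makes the
    variance bound apply directly. *)
Lemma bernstein_approx (F : R -> R[i]) (e C x : R) n : 0 <= C -> 0 <= x <= 1 ->
  (forall y, 0 <= y <= 1 -> cnorm (F x - F y) <= e + C * (x - y) ^+ 2) ->
  cnorm (F x - bernstein n.+1 (fun k => F (k%:R / n.+1%:R)) x%:C%C)
  <= e + C / n.+1%:R.
Proof.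
move=> C0 x01 h; set N := n.+1; have N0 : 0 < N%:R :> R by rewrite ltr0n.
have /andP[x0 x1] := x01.
have -> : F x - bernstein N (fun k => F (k%:R / N%:R)) x%:C%C =
    bernstein N (fun k => 1 * F x + -1 * F (k%:R / N%:R)) x%:C%C.
  by rewrite bernstein_comb bernstein_cst mul1r mulN1r.
pose psi k : R := 1 * e + C / N%:R ^+ 2 * (k%:R - N%:R * x) ^+ 2.
apply: le_trans (@cnorm_bernstein_le _ _ psi _ x01 _) _.
  move=> k kN; rewrite mul1r mulN1r /psi mul1r.
  have -> : C / N%:R ^+ 2 * (k%:R - N%:R * x) ^+ 2 = C * (x - k%:R / N%:R) ^+ 2.
    by field; rewrite gt_eqF.
  by apply: h; rewrite divr_ge0 // ler_pdivrMr // mul1r ler_nat kN.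
rewrite /psi bernstein_comb bernstein_cst bernstein_sqr.
rewrite subrr mul1r expr0n addr0 lerD2l.
have -> : C / N%:R ^+ 2 * (N%:R * x * (1 - x)) = C / N%:R * (x * (1 - x)).
  by field; rewrite gt_eqF.
by apply: ler_piMr; [rewrite divr_ge0 // ltW | nra].
Qed.

Lemma bernstein_uniform (F : R -> R[i]) :
  (forall e : R, 0 < e -> exists2 C, 0 <= C &
    forall x y, 0 <= x <= 1 -> 0 <= y <= 1 ->
      cnorm (F x - F y) <= e + C * (x - y) ^+ 2) ->
  forall e : R, 0 < e -> exists n, forall x, 0 <= x <= 1 ->
    cnorm (F x - bernstein n.+1 (fun k => F (k%:R / n.+1%:R)) x%:C%C) <= e.
Proof.
move=> h e e0; have e2 : 0 < e / 2 by rewrite divr_gt0.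
have [C C0 hC] := h _ e2; exists (Num.truncn (C / (e / 2))) => x x01.
apply: le_trans (bernstein_approx _ C0 x01 _) _; first by move=> y; exact: hC.
rewrite [leRHS]splitr lerD2l ler_pdivrMr // mulrC -ler_pdivrMr //.
by apply: ltW; rewrite truncnS_gt.
Qed.

Lemma dist_sqrt_le (x y : R) : 0 <= x -> 0 <= y ->
  `|Num.sqrt x - Num.sqrt y| ^+ 4 <= (x - y) ^+ 2.
Proof.
move=> x0 y0; rewrite -{2}(sqr_sqrtr x0) -{2}(sqr_sqrtr y0).
have := sqrtr_ge0 x; have := sqrtr_ge0 y.
set a := Num.sqrt x; set b := Num.sqrt y => b0 a0.
have ab : `|a - b| <= a + b by rewrite ler_norml; lra.
have -> : (a ^+ 2 - b ^+ 2) ^+ 2 = `|a - b| ^+ 2 * (a + b) ^+ 2.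
  by rewrite real_normK ?num_real //; ring.
rewrite (exprD _ 2 2); apply: ler_wpM2l; first by rewrite exprn_ge0.
by rewrite lerXn2r ?nnegrE // addr_ge0.
Qed.

End Bernstein.

(** * The generator of C_0((0,1]) *)

Section C0Extension.
Context (R : realType).
Implicit Types f : C0 R.

Lemma val_Ioc01 (x : @Ioc01 R) : 0 < val x <= 1.
Proof. by have := set_mem (valP x); rewrite /Ioc01 /= in_itv. Qed.

Definition C0_ext0 f : R -> R[i] := valL_ (0 : R[i]^o) f.

Lemma C0_ext0E f (x : @Ioc01 R) : C0_ext0 f (val x) = f x.
Proof.
by have /(congr1 (fun h => h x)) := @valLK _ _ (0 : R[i]^o) (@Ioc01 R) f.
Qed.

Lemma C0_ext0_0 f : C0_ext0 f 0 = 0.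
Proof.
rewrite /C0_ext0 /valL_ /= oinv_set_val insubF //.
by apply/negP => /set_mem; rewrite /Ioc01 /= in_itv /= ltxx.
Qed.

Lemma cnorm_ext0_le f (x : R) : cnorm (C0_ext0 f x) <= C0_sup f.
Proof.
have [xI|xI] := pselect (@Ioc01 R x).
  by have := C0_ext0E f (exist _ x (mem_set xI)); rewrite /= => ->; exact: C0_sup_ge.
rewrite /C0_ext0 /valL_ /= oinv_set_val insubF ?cnorm0 ?C0_sup_ge0 //.
by apply/negP => /set_mem.
Qed.

Lemma C0_ext0_continuous f (x e : R) : 0 <= x <= 1 -> 0 < e ->
  exists2 d, 0 < d & forall y, 0 <= y <= 1 -> `|x - y| < d ->
    cnorm (C0_ext0 f x - C0_ext0 f y) < e.
Proof.
move=> /andP[x0 x1] e0; have Ioc y : 0 < y -> y <= 1 -> @Ioc01 R y.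
  by move=> ? ?; rewrite /Ioc01 /= in_itv /=; apply/andP.
have [xp|] := ltP 0 x.
  have := @subspace_valL_continuousP' _ (@Ioc01 R) (R[i]^o) 0 f.
  move=> [_ /(_ (@C0_continuous R f))] /subspace_continuousP /(_ _ (Ioc _ xp x1)).
  move=> /cvgrPdist_lt /(_ e%:C%C); rewrite ltcR => /(_ e0).
  rewrite near_withinE => /nbhs_ballP[d /= d0 H].
  exists (Num.min d x); first by rewrite lt_min d0.
  move=> y /andP[y0 y1]; rewrite lt_min => /andP[yd yx].
  have yp : 0 < y by move: yx; rewrite ltr_norml; lra.
  by have := H y; rewrite /ball /= cnormE ltcR; apply=> //; exact: Ioc.
move=> xle; have -> : x = 0 by apply/le_anti; rewrite xle.
have [d d0 h] := C0_vanishing f e0; exists d => // y /andP[y0 y1].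
rewrite C0_ext0_0 !sub0r normrN cnormN => yd.
move: y0; rewrite le_eqVlt => /orP[/eqP <-|yp]; first by rewrite C0_ext0_0 cnorm0.
have := h (exist _ y (mem_set (Ioc _ yp y1))); rewrite -C0_ext0E; apply.
by rewrite /= (le_lt_trans (ler_norm y)).
Qed.

(** Heine's theorem for the extension by zero to the compact [0, 1]. *)
Lemma C0_ext0_uniform f (e : R) : 0 < e ->
  exists2 d, 0 < d & forall x y, 0 <= x <= 1 -> 0 <= y <= 1 -> `|x - y| < d ->
    cnorm (C0_ext0 f x - C0_ext0 f y) < e.
Proof.
move=> e0; have e2 : 0 < e / 2 by rewrite divr_gt0.
have /compact_near_coveringP := @segment_compact R 0 1.
pose P (d x : R) := forall y, 0 <= x <= 1 -> 0 <= y <= 1 -> `|x - y| < d ->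
    cnorm (C0_ext0 f x - C0_ext0 f y) < e.
move=> /(_ _ (0 : R)^'+ P _) [].
  move=> x; rewrite /= in_itv /= => x01.
  have [d d0 hd] := C0_ext0_continuous f x01 e2.
  have d2 : 0 < d / 2 by rewrite divr_gt0.
  near=> z c => y z01 y01 zy.
  have xz : `|x - z| < d / 2 by near: z; exact: nbhsx_ballx.
  have cd : c < d / 2 by near: c; exact: nbhs_right_lt.
  have xy : `|x - y| < d.
    rewrite (le_lt_trans (ler_distD z _ _)) // [d]splitr ltrD // (lt_trans zy) //.
  have h1 := hd _ y01 xy.
  have h2 : cnorm (C0_ext0 f x - C0_ext0 f z) < e / 2.
    by apply: hd => //; rewrite (lt_trans xz) // ltr_pdivrMr // ltr_pMr // ltr1n.
  have -> : C0_ext0 f z - C0_ext0 f y =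
    (C0_ext0 f x - C0_ext0 f y) - (C0_ext0 f x - C0_ext0 f z) by ring.
  by rewrite (le_lt_trans (cnormD _ _)) // cnormN [e]splitr ltrD.
move=> d /= d0 H; have d2 : 0 < d / 2 by rewrite divr_gt0.
exists (d / 2) => // x y x01 y01 xy; apply: (H (d / 2)) => //.
by rewrite /= sub0r normrN gtr0_norm // ltr_pdivrMr // ltr_pMr // ltr1n.
Unshelve. all: by end_near. Qed.

End C0Extension.

(** Iterated triple products of [w] are odd powers of [w].  They generate the
    even powers as well, since any function on (0,1] extends to an odd one. *)
Section OddGenerator.
Context (R : realType).
Variable S : set (C0 R).
Hypothesis S_TRO : subTRO S.
Hypothesis Sw : S (@C0_w R).

Let w : C0 R := @C0_w R.
Let u : C0 R := w ** w.

Lemma subTRO_D f g : S f -> S g -> S (f + g).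
Proof. by case: S_TRO => _ _ h _ Sf Sg; rewrite -[f]scale1r; exact: h. Qed.

Lemma subTRO_Z c f : S f -> S (c *: f).
Proof. by case: S_TRO => _ S0 h _ Sf; rewrite -[c *: f]addr0; exact: h. Qed.

Lemma subTRO_B f g : S f -> S g -> S (f - g).
Proof. by move=> Sf Sg; rewrite -scaleN1r; apply/subTRO_D/subTRO_Z. Qed.

Lemma subTRO_mul_w2 f : S f -> S (u ** f).
Proof.
move=> Sf; have -> : u ** f = triple w w f.
  have ws : star w = w.
    by apply: C0_ext => x; apply/CrealP/complex_realP; exists (val x).
  by rewrite /triple ws.
by case: S_TRO => _ _ _; exact.
Qed.

Lemma C0_w2M (f : C0 R) x : (u ** f) x = (val x ^+ 2)%:C%C * f x.
Proof. by rewrite -[LHS]/((val x)%:C%C * (val x)%:C%C * f x) -rmorphM. Qed.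

(** The product of [f] and of the Bernstein polynomial of [phi] in [w^2]; it is
    defined by the same recursion in order not to leave C_0((0,1]), which has
    no unit. *)
Fixpoint C0_bernstein (n : nat) (phi : nat -> R[i]) (f : C0 R) : C0 R :=
  if n is m.+1 then
    u ** C0_bernstein m (phi \o succn) f
    + (C0_bernstein m phi f - u ** C0_bernstein m phi f)
  else phi 0%N *: f.

Lemma subTRO_bernstein n phi f : S f -> S (C0_bernstein n phi f).
Proof.
move=> Sf; elim: n phi => [|n IH] phi /=; first exact: subTRO_Z.
by apply: subTRO_D; [|apply: subTRO_B => //]; exact: subTRO_mul_w2.
Qed.

Lemma C0_bernsteinE n phi f x :
  C0_bernstein n phi f x = f x * bernstein n phi (val x ^+ 2)%:C%C.
Proof.
elim: n phi => [|n IH] phi /=; first exact: mulrC.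
rewrite -[LHS]/((u ** C0_bernstein n (phi \o succn) f) x +
  (C0_bernstein n phi f x - (u ** C0_bernstein n phi f) x)).
rewrite !C0_w2M !IH; ring.
Qed.

(** The Bernstein polynomial of [phi] in [w^2] itself, which is in C_0((0,1])
    when its constant term [phi 0] vanishes. *)
Fixpoint C0_bernstein_poly (n : nat) (phi : nat -> R[i]) : C0 R :=
  if n is m.+1 then
    C0_bernstein m (phi \o succn) u
    + (C0_bernstein_poly m phi - u ** C0_bernstein_poly m phi)
  else 0.

Lemma subTRO_bernstein1 n phi : S u -> S (C0_bernstein_poly n phi).
Proof.
move=> Su; elim: n => [|n IH] /=; first by case: S_TRO.
apply: subTRO_D; first exact: subTRO_bernstein.
by apply: subTRO_B => //; exact: subTRO_mul_w2.
Qed.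

Lemma C0_bernstein_polyE n phi x : phi 0%N = 0 ->
  C0_bernstein_poly n phi x = bernstein n phi (val x ^+ 2)%:C%C.
Proof.
move=> phi0; elim: n => [|n IH] /=; first by rewrite phi0.
rewrite -[LHS]/(C0_bernstein n (phi \o succn) u x +
  (C0_bernstein_poly n phi x - (u ** C0_bernstein_poly n phi) x)).
rewrite C0_w2M C0_bernsteinE IH.
have -> : u x = (val x ^+ 2)%:C%C.
  by rewrite -[LHS]/((val x)%:C%C * (val x)%:C%C) -rmorphM.
ring.
Qed.

Lemma C0_approx_mem (f : C0 R) :
  (forall e : R, 0 < e -> exists2 g, S g & forall x, cnorm (f x - g x) <= e) ->
  S f.
Proof.
move=> h; case: S_TRO => cS _ _ _; apply: ((closed_nrm S).1 cS) => e e0.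
have [|g Sg fg] := h (e / 2); first by rewrite divr_gt0.
exists g => //; apply: (@le_lt_trans _ _ (e / 2)); first exact: C0_sup_le.
by rewrite ltr_pdivrMr // ltr_pMr // ltr1n.
Qed.

(** [w^2 = w * Num.sqrt (w^2)], where the continuous function [Num.sqrt] is
    approximated by polynomials; products of [w] and a polynomial in [w^2] are
    in [S] since multiplication by [w^2] is a triple product. *)
Lemma subTRO_w2 : S u.
Proof.
apply: C0_approx_mem => e e0; pose F x : R[i] := (Num.sqrt x)%:C%C.
have [|n hn] := @bernstein_uniform R F _ e e0.
  (* t = t * 1 <= t * (t / d) ^+ 3 when d < t *)
  move=> d d0; exists (d ^- 3); first by rewrite invr_ge0 exprn_ge0 // ltW.
  move=> x y /andP[x0 _] /andP[y0 _]; rewrite /F -rmorphB /= cnorm_real.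
  have := dist_sqrt_le x0 y0; set t := `|_ - _| => txy.
  have t0 : 0 <= t by exact: normr_ge0.
  have d3 : 0 < d ^- 3 by rewrite invr_gt0 exprn_gt0.
  have [td|dt] := leP t d.
    by apply: ler_wpDr => //; rewrite mulr_ge0 ?sqr_ge0 //; exact: ltW.
  apply: ler_wpDl; first exact: ltW.
  rewrite mulrC ler_pdivlMr ?exprn_gt0 //; apply: le_trans txy.
  rewrite (exprS t 3).
  by rewrite ler_wpM2l // lerXn2r ?nnegrE //; exact: ltW.
exists (C0_bernstein n.+1 (fun k => F (k%:R / n.+1%:R)) w).
  exact: subTRO_bernstein.
move=> x; rewrite C0_bernsteinE; have /andP[x0 x1] := val_Ioc01 x.
have -> : u x = w x * F (val x ^+ 2).
  by rewrite /F sqrtr_sqr ger0_norm ?ltW.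
rewrite -mulrBr cnormM; have -> : cnorm (w x) = val x.
  by rewrite -[w x]/((val x)%:C%C) cnorm_real ger0_norm ?ltW.
rewrite -[leRHS]mul1r; apply: ler_pM; rewrite ?cnorm_ge0 //; first exact: ltW.
by apply: hn; rewrite exprn_ge0 /= ?expr_le1 //; exact: ltW.
Qed.

(** A continuous function that vanishes at 0 is a continuous function of [w^2]
    without constant term. *)
Lemma subTRO_w_full (f : C0 R) : S f.
Proof.
apply: C0_approx_mem => e e0; pose F x : R[i] := C0_ext0 f (Num.sqrt x).
have M0 := C0_sup_ge0 f; set M := C0_sup f in M0.
have [|n hn] := @bernstein_uniform R F _ e e0.
  move=> d d0; have [c c0 hc] := C0_ext0_uniform f d0.
  have K0 : 0 <= 2 * M * c ^- 4.
    by apply: mulr_ge0; [rewrite mulr_ge0 | rewrite invr_ge0 exprn_ge0 // ltW].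
  exists (2 * M * c ^- 4) => //.
  move=> x y /andP[x0 x1] /andP[y0 y1].
  have := dist_sqrt_le x0 y0; set t := `|_ - _| => txy.
  have c4 : 0 < c ^+ 4 by rewrite exprn_gt0.
  have s1 (z : R) : z <= 1 -> 0 <= Num.sqrt z <= 1.
    by move=> z1; rewrite sqrtr_ge0 -sqrtr1 ler_wsqrtr.
  have [tc|ct] := ltP t c.
    apply: ler_wpDr; last exact: ltW (hc _ _ (s1 _ x1) (s1 _ y1) tc).
    by rewrite mulr_ge0 ?sqr_ge0.
  apply: ler_wpDl; first exact: ltW.
  (* 1 <= (t / c) ^+ 4 when c <= t *)
  apply: (@le_trans _ _ (2 * M * 1)).
    rewrite mulr1 mulr_natl mulr2n (le_trans (cnormD _ _)) // cnormN.
    by rewrite lerD // cnorm_ext0_le.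
  rewrite -[leRHS]mulrA; apply: ler_wpM2l; first by rewrite mulr_ge0.
  rewrite mulrC ler_pdivlMr // mul1r; apply: le_trans txy.
  by rewrite lerXn2r ?nnegrE ?normr_ge0 //; exact: ltW.
exists (C0_bernstein_poly n.+1 (fun k => F (k%:R / n.+1%:R))).
  by apply: subTRO_bernstein1; exact: subTRO_w2.
move=> x; rewrite C0_bernstein_polyE; last by rewrite mul0r /F sqrtr0 C0_ext0_0.
have /andP[x0 x1] := val_Ioc01 x.
have -> : f x = F (val x ^+ 2) by rewrite /F sqrtr_sqr gtr0_norm // C0_ext0E.
by apply: hn; rewrite exprn_ge0 /= ?expr_le1 //; exact: ltW.
Qed.

End OddGenerator.

(** * The generated TRO and the range *)

Lemma preimage_subTRO (R : realType) (D B : cstarAlgType R)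
    (Phi : {linear D -> B}) (V : set B) :
  TRO_hom Phi -> subTRO V -> subTRO (Phi @^-1` V).
Proof.
move=> PhiT [cV V0 VL VT]; split.
- apply/closed_nrm => x hx; apply: ((closed_nrm V).1 cV) => e e0.
  have [|y Vy xy] := hx (e / 4); first by rewrite divr_gt0.
  exists (Phi y) => //; rewrite -raddfB.
  by apply: le_lt_trans (TRO_hom_bounded PhiT _) _; rewrite mulrC -ltr_pdivlMr.
- by rewrite /= raddf0.
- by move=> c x y Vx Vy; rewrite /= linearP; exact: VL.
- by move=> x y z Vx Vy Vz; rewrite /= PhiT; exact: VT.
Qed.

Lemma range_subTRO (R : realType) (D B : cstarAlgType R)
    (Phi : {linear D -> B}) :
  TRO_hom Phi -> subTRO (range Phi).
Proof.
move=> PhiT; split; first exact: TRO_hom_range_closed.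
- by exists 0 => //; rewrite raddf0.
- by move=> c _ _ [x _ <-] [y _ <-]; exists (c *: x + y) => //; rewrite linearP.
- move=> _ _ _ [x _ <-] [y _ <-] [z _ <-].
  by exists (triple x y z) => //; rewrite PhiT.
Qed.

(** The functions [f] with [f (x) a] in [W] for all [a] form a closed subTRO:
    [f g^* k (x) a b^* c] is a triple product of elements of [W], and triple
    products [a b^* c] are dense in [A]. *)
Lemma tensor_generated (R : realType) (A D : cstarAlgType R)
    (t : C0 R -> A -> D) (W : set D) : cstar_tensor_product t -> subTRO W ->
  (forall a, W (t (C0_w R) a)) -> W = setT.
Proof.
move=> tT [cW W0 WL WT] Ww.
have approx d : (forall e, 0 < e -> exists2 c, W c & nrm (d - c) < e) -> W d.
  exact: (closed_nrm W).1.
pose S : set (C0 R) := [set f | forall a, W (t f a)].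
have S_TRO : subTRO S.
  split.
  - apply/closed_nrm => f hf a; apply: approx => e e0.
    pose M := 16 * nrm a + 1.
    have M0 : 0 < M by rewrite ltr_wpDl // mulr_ge0 ?nrm_ge0.
    have [|g Sg fg] := hf (e / M); first by rewrite divr_gt0.
    exists (t g a); first exact: Sg.
    rewrite -(tensorBl tT).
    apply: le_lt_trans (nrm_tensor_le tT _ _) _; rewrite ltr_pdivlMr // in fg.
    apply: le_lt_trans fg; rewrite (mulrC 16) -mulrA ler_wpM2l ?nrm_ge0 //.
    by rewrite /M lerDl.
  - by move=> a; rewrite -(subrr 0) (tensorBl tT) subrr.
  - by move=> c f g Sf Sg a; rewrite (tensor_linearl tT); exact: WL.
  - move=> f g k Sf Sg Sk a; apply: approx => e e0.
    pose M := 16 * nrm (triple f g k) + 1.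
    have M0 : 0 < M by rewrite ltr_wpDl // mulr_ge0 ?nrm_ge0.
    have [|b ab] := triple_approx a (e := e / M); first by rewrite divr_gt0.
    exists (t (triple f g k) (triple a a b)).
      by rewrite /triple -!(tensor_mul tT) -(tensor_star tT); exact: WT.
    rewrite -(tensorBr tT).
    apply: le_lt_trans (nrm_tensor_le tT _ _) _; rewrite ltr_pdivlMr // in ab.
    by apply: le_lt_trans ab; rewrite mulrC ler_wpM2l ?nrm_ge0 // /M lerDl.
have Wt f a : W (t f a) by apply: (subTRO_w_full S_TRO _ f).
apply/seteqP; split=> // d _; apply: approx => e e0.
case: (tT) => _ _ _ dense_t.
have [||c [dc [n [f [a cE]]]]] := dense_t (ball d e%:C%C).
- by exists d; apply: ballxx; rewrite ltcR.
- by apply: ball_open; rewrite ltcR.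
exists c; last by move: dc; rewrite -ball_normE /ball_ /= normE ltcR.
rewrite cE; elim/big_ind: _ => // x y Wx Wy.
by rewrite -[x]scale1r; exact: WL.
Qed.


Theorem corollary22 (R : realType) (A B : cstarAlgType R)
    (T : {linear A -> B})
    (T_contractive : contractive T)
    (T_cop : completely_orthogonality_preserving T)
    (D : cstarAlgType R) (tensor : C0 R -> A -> D)
    (D_tensor : cstar_tensor_product tensor)
    (Phi : {linear D -> B})
    (Phi_TRO : TRO_hom Phi)
    (Phi_w : forall a : A, Phi (tensor (C0_w R) a) = T a) :
  TRO (range T) = range Phi.
Proof.
apply/seteqP; split.
  apply: smallest_sub; first exact: range_subTRO.
  by move=> _ [a _ <-]; rewrite -Phi_w; exists (tensor (C0_w R) a).
move=> _ [d _ <-] V [V_TRO TV].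
have /(congr1 (fun X => X d)) : Phi @^-1` V = setT.
  apply: (tensor_generated D_tensor); first exact: preimage_subTRO.
  by move=> a; rewrite /= Phi_w; apply: TV; exists a.
by rewrite /= => ->.
Qed.
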